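(* Let $d\ge 1$, let $\mathcal{P}=(0,1)^{d+1}\subset\mathbb{R}^{d+1}=\mathbb{R}\times\mathbb{R}^d$, and let $a$ be a real-valued function on $\mathcal{P}$ of class $BMO^{x}_{1}(\mathcal{P})$. Then there exists a real-valued function $\hat a$ on $\mathbb{R}^{d+1}$ such that $$ \hat a=a\quad\text{on}\quad\mathcal{P},\qquad [\hat a]^{\sharp}_{\infty,\mathbb{R}^{d+1}}\le 3^{2+2d}\,[a]^{\sharp}_{1,\mathcal{P}}. $$
   Context: Points of $\mathbb{R}^{d+1}=\mathbb{R}\times\mathbb{R}^d$ are written $(t,x)$ with $t\in\mathbb{R}$, $x\in\mathbb{R}^d$. Functions are Lebesgue measurable. For $\rho>0$, $\mathbb{C}_\rho$ denotes the collection of cubes $x+(0,\rho)^d$, $x\in\mathbb{R}^d$, and $\mathbb{Q}_\rho$ denotes the collection of parabolic boxes $Q=(s,s+\rho^2)\times C$ with $s\in\mathbb{R}$, $C\in\mathbb{C}_\rho$. For such $Q$ set $Q^{z}=(s,s+\rho^2)$ (the time interval) and $Q^{\tau}=C$ (the spatial cube). For a domain $\mathcal{O}\subset\mathbb{R}^{d+1}$, $\mathbb{Q}_\rho(\mathcal{O})$ is the collection of $Q\in\mathbb{Q}_\rho$ with $Q\subset\mathcal{O}$. For a domain $\mathcal{O}\subset\mathbb{R}^{d+1}$, $\rho_0\in(0,\infty]$, and a function $a$ on $\mathcal{O}$, define $$ [a]^{\sharp}_{\rho_0,\mathcal{O}}:=\sup_{\rho\le\rho_0}\ \sup_{Q\in\mathbb{Q}_\rho(\mathcal{O})}\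 \frac{1}{|Q^{z}|\,|Q^{\tau}|^2}\int_{Q^{z}}\int_{Q^{\tau}}\int_{Q^{\tau}}|a(t,x)-a(t,y)|\,dx\,dy\,dt, $$ where $\rho$ ranges over finite positive numbers and $|\cdot|$ of a set is Lebesgue measure. One writes $a\in BMO^{x}_{\rho_0}(\mathcal{O})$ if $[a]^{\sharp}_{\rho_0,\mathcal{O}}<\infty$. *)

(* Defs.v *)
From HB Require Import structures.
From mathcomp Require Import all_boot all_order all_algebra.
From mathcomp Require Import all_classical all_reals all_analysis.

Set Implicit Arguments.
Unset Strict Implicit.
Unset Printing Implicit Defensive.

Import Order.TTheory GRing.Theory Num.Theory.
Import numFieldNormedType.Exports.

Local Open Scope classical_set_scope.
Local Open Scope ring_scope.

(* R^d is [d.-tuple R] and R^(d+1) = R x R^d is [(R * d.-tuple R)%type].  The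
   library has no d-dimensional Lebesgue measure: it is built by iterated
   products on the Borel sigma-algebra, then completed. *)

Section borel_lebesgue.
Context {R : realType}.
Local Open Scope ereal_scope.

Definition cons_pair n (z : measurableTypeR R * n.-tuple (measurableTypeR R)) :
  n.+1.-tuple (measurableTypeR R) := [tuple of z.1 :: z.2].

Lemma measurable_cons_pair n : measurable_fun [set: _] (@cons_pair n).
Proof. exact: measurable_cons. Qed.

Section step.
Variable n : nat.
Variable mu : {sigma_finite_measure set (n.-tuple (measurableTypeR R)) -> \bar R}.

Definition cons_measure : set (n.+1.-tuple (measurableTypeR R)) -> \bar R :=
  pushforward (@lebesgue_measure R \x mu) (@cons_pair n).

Let cm0 : cons_measure set0 = 0.
Proof. by rewrite /cons_measure /pushforward preimage_set0 measure0. Qed.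

Let cm_ge0 A : 0 <= cons_measure A.
Proof. by rewrite /cons_measure /pushforward; exact: measure_ge0. Qed.

Let cm_sigma_additive : semi_sigma_additive cons_measure.
Proof.
apply: measure_semi_sigma_additive; exact: measurable_cons_pair.
Qed.

HB.instance Definition _ := isMeasure.Build _ _ _ cons_measure
  cm0 cm_ge0 cm_sigma_additive.

Let cm_sigma_finite : sigma_finite setT cons_measure.
Proof.
have /sigma_finiteP[F [TF ndF Foo]] := sigma_finiteT (@lebesgue_measure R).
have /sigma_finiteP[G [TG ndG Goo]] := sigma_finiteT mu.
pose split_cons (y : n.+1.-tuple (measurableTypeR R)) :
  measurableTypeR R * n.-tuple (measurableTypeR R) :=
  (thead y, [tuple of behead y]).
have split_consK z : split_cons (cons_pair z) = z.
  by case: z => u v; congr pair => //; exact/val_inj.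
have msplit : measurable_fun setT split_cons.
  apply/measurable_fun_pair; first exact: measurable_tnth.
  exact: measurable_behead.
exists (fun k => split_cons @^-1` (F k `*` G k)).
  rewrite -preimage_bigcup [X in _ @^-1` X](_ : _ = setT) ?preimage_setT//.
  rewrite -setXTT TF TG predeqE => -[x y]; split; last first.
    move=> [/= [i _ Fx] [k _ Gy]]; exists (maxn i k) => //; split.
    - by move: x Fx; exact/subsetPset/ndF/leq_maxl.
    - by move: y Gy; exact/subsetPset/ndG/leq_maxr.
  by move=> [i _ []/= ? ?]; split; exists i.
move=> k; have [mF Fk] := Foo k; have [mG Gk] := Goo k; split.
  by rewrite -[X in measurable X]setTI; apply: msplit => //; exact: measurableX.
rewrite /cons_measure /pushforward (_ : _ @^-1` _ = F k `*` G k); last first.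
  by apply/seteqP; split => z; rewrite /preimage /mkset split_consK.
by rewrite product_measure1E// lte_mul_pinfty// ge0_fin_numE.
Qed.

HB.instance Definition _ :=
  @Measure_isSigmaFinite.Build _ _ _ cons_measure cm_sigma_finite.

End step.

Fixpoint borel_lebesgue (d : nat) :
    {sigma_finite_measure set (d.-tuple (measurableTypeR R)) -> \bar R} :=
  if d is n.+1 then cons_measure (borel_lebesgue n) else \d_[tuple].

End borel_lebesgue.

Section lebesgue.
Context {R : realType}.
Local Open Scope ereal_scope.

(* Lebesgue measure on R^d, on the sigma-algebra of Lebesgue measurable sets. *)
Definition lebesgue_space (d : nat) :=
  @completed_measure_extension _ _ _ (@borel_lebesgue R d).

HB.instance Definition _ d := Measure.on (@lebesgue_space d).

(* A set is Lebesgue measurable in R x R^d when it is Caratheodory measurable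
   for the Lebesgue outer measure. *)
Definition lebesgue_measurable_fun (d : nat) (O : set (R * d.-tuple R))
    (a : R * d.-tuple R -> R) : Prop :=
  measurable_fun (O : set (caratheodory_type
    ((@lebesgue_measure R \x @borel_lebesgue R d)^*)%mu)) a.

End lebesgue.
Arguments lebesgue_space {R} d _.

Section bmo.
Context {R : realType} {d : nat}.

Definition cube (x : d.-tuple R) (rho : R) : set (d.-tuple R) :=
  [set y | forall i : 'I_d, tnth x i < tnth y i < tnth x i + rho].

(* A box is the pair of its time interval and its spatial cube; the functions
   on O are total functions, whose values outside O are never used. *)
Definition parabolic_boxes (rho : R) (O : set (R * d.-tuple R)) :
    set (set R * set (d.-tuple R)) :=
  [set Q | (exists (s : R) (x : d.-tuple R),
             Q = (`]s, s + rho ^+ 2[%classic, cube x rho))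
           /\ Q.1 `*` Q.2 `<=` O].

Local Open Scope ereal_scope.

Definition mean_oscillation (a : R * d.-tuple R -> R)
    (Q : set R * set (d.-tuple R)) : \bar R :=
  (\int[completed_lebesgue_measure]_(t in Q.1)
     \int[lebesgue_space d]_(y in Q.2)
       \int[lebesgue_space d]_(x in Q.2) `|a (t, x) - a (t, y)|%:E)
  / (completed_lebesgue_measure Q.1 * (lebesgue_space d Q.2) ^+ 2).

Definition bmo_seminorm (rho0 : \bar R) (O : set (R * d.-tuple R))
    (a : R * d.-tuple R -> R) : \bar R :=
  ereal_sup [set mean_oscillation a Q | Q in
    \bigcup_(rho in [set rho : R | (0 < rho)%R /\ rho%:E <= rho0])
      parabolic_boxes rho O].

Definition bmo_x (rho0 : \bar R) (O : set (R * d.-tuple R))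
    (a : R * d.-tuple R -> R) : Prop :=
  bmo_seminorm rho0 O a < +oo.

Definition unit_cube : set (R * d.-tuple R) :=
  [set z | (0 < z.1 < 1)%R /\ forall i : 'I_d, (0 < tnth z.2 i < 1)%R].

End bmo.

(* Main.v *)
(* Extend [a] by even reflection across the faces of the unit cube and then
   2-periodically: ahat = a o fold, where [fold] is the triangle wave acting on
   each coordinate.  A box of side rho is folded into a box of side
   rho' = min(rho, 1) inside the cube: [fold] is 1-Lipschitz with values in
   [0, 1], so it maps an interval of length L into one of length min(L, 1), and
   it is an isometry on each of the at most 3 L / min(L, 1) unit cells that the
   interval meets.  One time integral and two spatial ones then cost the factor
   3 (3^d)^2, normalized by the volumes of the two boxes.

   The library's integral of a nonnegative function is the supremum of the
   integrals of the simple functions below it, hence a lower integral that makes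
   sense for arbitrary functions.  The folding inequality is proved at that
   level, so no measurability of the sections of [a] is needed; measurability
   only enters for ahat itself, which is [a] composed with countably many
   measure preserving maps. *)
Require Import Defs.
From mathcomp Require Import all_boot all_order all_algebra.
From mathcomp Require Import all_classical all_reals all_analysis.
From mathcomp Require Import measurable_realfun.
From mathcomp Require Import ring lra zify.

Set Implicit Arguments.
Unset Strict Implicit.
Unset Printing Implicit Defensive.
Import Order.TTheory GRing.Theory Num.Theory.
Import numFieldNormedType.Exports HBNNSimple.
Local Open Scope classical_set_scope.
Local Open Scope ring_scope.

(** * Lower integrals and folding *)

Section lower_integral.
Context d (T : measurableType d) (R : realType).
Variable mu : {measure set T -> \bar R}.
Local Open Scope ereal_scope.
Implicit Types (D : set T) (f g h : T -> \bar R).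

(** The integral is a supremum over simple functions below [f \_ D], so it suffices to bound the
    integrals of measurable minorants [h]. Each bound below on an arbitrary integrand enters through
    such an [h]. *)
Lemma ge0_integral_le_simple D f M : (forall x, D x -> 0 <= f x) ->
  (forall h, measurable_fun setT h -> (forall x, 0 <= h x) ->
    (forall x, h x <= (f \_ D) x) -> \int[mu]_x h x <= M) ->
  \int[mu]_(x in D) f x <= M.
Proof.
move=> f0 fM; rewrite ge0_integralE//; apply: ge_ereal_sup => _ [h /= hf <-].
rewrite -integralT_nnsfun; apply: fM => //; first exact/measurable_EFinP.
by move=> x; rewrite lee_fin; exact: fun_ge0.
Qed.

Lemma le_integral_restrict D E f g : (forall x, D x -> 0 <= f x) ->
  (forall x, E x -> 0 <= g x) -> (forall x, (f \_ D) x <= (g \_ E) x) ->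
  \int[mu]_(x in D) f x <= \int[mu]_(x in E) g x.
Proof.
move=> f0 g0 fg; rewrite !ge0_integralE//; apply: le_ereal_sup.
by move=> _ [h /= hf <-]; exists h => // x; exact: le_trans (hf x) (fg x).
Qed.

Lemma le_integral_ge0 D f g : (forall x, D x -> 0 <= f x) ->
  (forall x, D x -> f x <= g x) ->
  \int[mu]_(x in D) f x <= \int[mu]_(x in D) g x.
Proof.
move=> f0 fg; apply: le_integral_restrict => // [x Dx|x].
  exact: le_trans (f0 x Dx) (fg x Dx).
by rewrite !patchE; case: ifPn => // /set_mem /fg.
Qed.

(** A measurable minorant [h] of [k * f] is [k] times the minorant [h / k] of [f], and scaling is
    exact for the measurable function [h / k]. *)
Lemma integral_mulr_le D f (k : R) : (0 < k)%R -> (forall x, D x -> 0 <= f x) ->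
  \int[mu]_(x in D) (k%:E * f x) <= k%:E * \int[mu]_(x in D) f x.
Proof.
move=> k0 f0; have k0' : 0 <= k%:E by rewrite lee_fin ltW.
apply: ge0_integral_le_simple => [x Dx|h mh h0 hf].
  by rewrite mule_ge0// f0.
have -> : h = fun x => k%:E * (k^-1%:E * h x).
  by apply/funext => x; rewrite muleA -EFinM divff ?gt_eqF// mul1e.
have ki0 : (0 <= k^-1 :> R)%R by rewrite invr_ge0 ltW.
have mkh : measurable_fun setT (fun x => k^-1%:E * h x).
  by exact: measurable_funeM.
have kh0 x : 0 <= k^-1%:E * h x by exact: mule_ge0.
rewrite ge0_integralZl_EFin //.
apply: lee_pmul => //; first exact: integral_ge0.
rewrite integral_mkcond [leRHS]integral_mkcond.
apply: le_integral_restrict => [x _|x _|x].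
- by rewrite patch_setT mule_ge0.
- by rewrite patchE; case: ifPn => // /set_mem /f0.
have := hf x; rewrite !patch_setT !patchE; case: ifPn => _ hx.
  by rewrite muleC lee_pdivrMr// muleC.
have -> : h x = 0 by apply/eqP; rewrite eq_le hx h0.
by rewrite mule0.
Qed.

(** A minorant of [f] on [D] is measurable, so its integral ignores the null set [D \ E]. This
    passes from closed intervals and boxes to open ones. *)
Lemma integral_le_eq_measure D E f : measurable D -> measurable E ->
  E `<=` D -> mu E = mu D -> mu D < +oo -> (forall x, D x -> 0 <= f x) ->
  \int[mu]_(x in D) f x <= \int[mu]_(x in E) f x.
Proof.
move=> mD mE ED muED Doo f0.
have DE0 : mu (D `\` E) = 0.
  have -> : mu (D `\` E) = mu D - mu E by rewrite measureD// setIidr.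
  by rewrite muED subee// ge0_fin_numE.
apply: ge0_integral_le_simple => // h mh h0 hf.
rewrite (@ge0_negligible_integral _ _ _ mu setT (D `\` E))//; last first.
  exact: measurableD.
apply: le_integral_restrict => // [x Ex|x]; first exact/f0/ED.
rewrite !patchE; case: ifPn => [/set_mem[_ nDE]|_].
  have := hf x; rewrite patchE; case: ifPn => [/set_mem Dx|nDx].
    by rewrite ifT// inE; apply: contrapT => nE; exact: nDE.
  rewrite ifF//; apply: contraNF nDx; rewrite !inE; exact: ED.
by case: ifPn => // /set_mem /ED /f0.
Qed.

End lower_integral.

Definition measure_preserving d (T : measurableType d) (R : realType)
    (mu : set T -> \bar R) (s : T -> T) :=
  measurable_fun setT s /\ forall A, measurable A -> mu (s @^-1` A) = mu A.

Section folding.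
Context d (T : measurableType d) (R : realType).
Variable mu : {measure set T -> \bar R}.
Local Open Scope ereal_scope.

Lemma integral_comp_measure_preserving (s : T -> T) (h : T -> \bar R) :
  measure_preserving mu s -> measurable_fun setT h -> (forall x, 0 <= h x) ->
  \int[mu]_x h (s x) = \int[mu]_x h x.
Proof.
move=> [ms mus] mh h0.
have := @ge0_integral_pushforward _ _ _ _ _ _ ms mu setT h.
rewrite preimage_setT => <-//.
apply: eq_measure_integral => A mA _; exact: mus.
Qed.

(* The right inverses [s j] of the branches of [F] cover [D], so a simple
   function below [f \o F] splits into #|J| pieces, each transported below [f]
   on [D']; no measurability of [f] is involved. *)
Lemma integral_fold_le (J : finType) (s : J -> T -> T) (Ej : J -> set T)
    (D D' : set T) (F : T -> T) (f : T -> \bar R) :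
  measurable D -> (forall j, measurable (Ej j)) ->
  (forall j, measure_preserving mu (s j)) ->
  D `<=` \bigcup_j Ej j ->
  (forall j x, D (s j x) -> Ej j (s j x) -> D' x /\ F (s j x) = x) ->
  (forall x, 0 <= f x) ->
  \int[mu]_(x in D) f (F x) <= #|J|%:R%:E * \int[mu]_(x in D') f x.
Proof.
move=> mD mE sP DE sF f0; apply: ge0_integral_le_simple => // h mh h0 hf.
pose g j x := h x * (\1_(D `&` Ej j) x)%:E.
have g0 j x : 0 <= g j x by rewrite mule_ge0// lee_fin.
have mg j : measurable_fun setT (g j).
  apply: emeasurable_funM => //; apply/measurable_EFinP.
  by apply: measurable_indic; exact: measurableI.
apply: (@le_trans _ _ (\int[mu]_x (\sum_(j <- enum J) g j x))).
  apply: le_integral_ge0 => // x _.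
  have [Dx|nDx] := pselect (D x); last first.
    have -> : h x = 0.
      by apply/eqP; rewrite eq_le h0 andbT (le_trans (hf x))// patchE memNset.
    exact: sume_ge0.
  (* The sets [Ej j] may overlap: one index covering [x] already contributes [h x], and the other
     terms are nonnegative. *)
  have [j _ Ejx] := DE x Dx.
  rewrite (_ : h x = g j x); last by rewrite /g indicE mem_set// mule1.
  rewrite (bigD1_seq j) ?mem_enum ?enum_uniq//= leeDl//.
  exact: sume_ge0.
rewrite ge0_integral_sum//.
rewrite (_ : #|J|%:R%:E * _ = \sum_(j <- enum J) \int[mu]_(x in D') f x).
  apply: lee_sum => j _; rewrite -(integral_comp_measure_preserving (sP j))//.
  apply: le_integral_restrict => // x; rewrite patch_setT /g indicE.
  have [/set_mem[Dx Ex]|_] := boolP (_ \in _); last first.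
    by rewrite mule0 patchE; case: ifPn.
  have [D'x Fx] := sF _ _ Dx Ex; rewrite mule1 patchE mem_set//.
  by rewrite (le_trans (hf _))// patchE mem_set// Fx.
rewrite big_const_seq count_predT -cardE iter_addr addr0.
by rewrite mule_natl.
Qed.

End folding.

(** * Isometries preserving Lebesgue measure *)

Section completed_preserving.
Context d (T : semiRingOfSetsType d) (R : realType).
Variable mu : {measure set T -> \bar R}.
Local Open Scope ereal_scope.
Local Notation mu_ext := (mu^*)%mu.

(** Pull back a countable cover of [A] by sets of the semiring and use countable subadditivity. *)
Lemma mu_ext_preimage_le (s : T -> T) :
  (forall A, measurable A -> mu_ext (s @^-1` A) <= mu A) ->
  forall A, mu_ext (s @^-1` A) <= mu_ext A.
Proof.
move=> smu A; apply: le_ereal_inf_tmp => _ [F [mF AF] <-].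
apply: (@le_trans _ _ (mu_ext (\bigcup_k (s @^-1` F k)))).
  by apply: le_mu_ext; rewrite -preimage_bigcup; exact: preimage_subset.
apply: (le_trans (outer_measure_sigma_subadditive mu_ext _)).
by apply: lee_nneseries => // k _; exact: smu.
Qed.

(** Neither [s] nor its inverse [t] increases the outer measure of preimages, so both preserve it.
    The Caratheodory condition for the preimage of [A], tested on [X], is then the one for [A],
    tested on the preimage of [X] under [t]. *)
Lemma completed_measure_preserving (s t : T -> T) :
  cancel s t -> cancel t s ->
  (forall A, measurable A -> mu_ext (s @^-1` A) <= mu A) ->
  (forall A, measurable A -> mu_ext (t @^-1` A) <= mu A) ->
  measure_preserving (@completed_measure_extension _ _ _ mu) s.
Proof.
move=> st ts smu tmu.
have tsE A : t @^-1` (s @^-1` A) = A.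
  by apply/seteqP; split=> x /=; rewrite /preimage /= ?ts.
have stE A : s @^-1` (t @^-1` A) = A.
  by apply/seteqP; split=> x /=; rewrite /preimage /= ?st.
have sE A : mu_ext (s @^-1` A) = mu_ext A.
  apply/eqP; rewrite eq_le mu_ext_preimage_le//=.
  by rewrite -[in leLHS](tsE A) mu_ext_preimage_le.
split=> [_ A mA|A _]; last exact: sE.
rewrite setTI; have: caratheodory_measurable mu_ext (s @^-1` A); last exact.
have mA' : caratheodory_measurable mu_ext A by exact: mA.
move=> X; have := mA' (t @^-1` X).
by rewrite -(sE (t @^-1` X)) -(sE (_ `&` A)) -(sE (_ `&` ~` A)) !preimage_setI
  stE.
Qed.

End completed_preserving.

Section affine.
Context {R : realType}.
Implicit Types (e : bool) (c x y : R).

Definition isom e c y : R := (-1) ^+ e * y + c.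

(** Since a sign is its own inverse, the inverse is again an [isom], and results on [isom] serve
    both directions. *)
Definition isom_inv e c y : R := isom e (- (-1) ^+ e * c) y.

Lemma isomK e c : cancel (isom e c) (isom_inv e c).
Proof.
by move=> y; rewrite /isom_inv /isom; case: e; rewrite /= ?expr1 ?expr0; ring.
Qed.

Lemma isom_invK e c : cancel (isom_inv e c) (isom e c).
Proof.
by move=> y; rewrite /isom_inv /isom; case: e; rewrite /= ?expr1 ?expr0; ring.
Qed.

Lemma measurable_isom e c :
  measurable_fun setT (isom e c : measurableTypeR R -> measurableTypeR R).
Proof.
apply: (@measurable_funD _ (measurableTypeR R) R setT
  (fun y => (-1) ^+ e * y) (cst c)) => //.
apply: (@measurable_funM _ (measurableTypeR R) R setT
  (cst ((-1) ^+ e)) idfun) => //.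
exact: measurable_id.
Qed.

Lemma preimage_isom_itv e c a b : isom e c @^-1` `]a, b] =
  [set` if e then `[c - b, c - a[ else `]a - c, b - c]].
Proof.
by case: e; apply/seteqP; split=> y;
  rewrite /isom /= !in_itv/= ?expr1 ?expr0; lra.
Qed.

(** By uniqueness of Lebesgue measure, it is enough to compare lengths of half-open intervals. A
    reflection moves the closed end to the other side, which leaves the length unchanged. *)
Lemma lebesgue_measure_isom e c :
  measure_preserving (@lebesgue_measure R) (isom e c).
Proof.
split=> [|A mA]; first exact: measurable_isom.
rewrite -[LHS]/(pushforward lebesgue_measure
  (isom e c : _ -> measurableTypeR R) A).
apply/esym/lebesgue_measure_unique => //; first exact: measurable_isom.
move=> misom _ [[a b] /= _ <-]; rewrite /pushforward preimage_isom_itv.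
rewrite lebesgue_measure_itv/=.
case: e {misom}; rewrite lebesgue_measure_itv/= !lte_fin.
  by rewrite -!EFinB ltrD2l ltrN2; congr (if _ then _%:E else _); ring.
by rewrite -!EFinB ltrD2r; congr (if _ then _%:E else _); ring.
Qed.

End affine.

Section product_preserving.
Context d1 d2 (T1 : measurableType d1) (T2 : measurableType d2) (R : realType).
Variables (m1 : {measure set T1 -> \bar R}).
Variable m2 : {sigma_finite_measure set T2 -> \bar R}.
Local Open Scope ereal_scope.

Definition pair_map (f : T1 -> T1) (g : T2 -> T2) (z : T1 * T2) : T1 * T2 :=
  (f z.1, g z.2).

(** The section at [x] of the preimage of [A] is the preimage under [g] of the section of [A] at
    [f x]; a change of variables by [f] then concludes. *)
Lemma product_measure_preserving (f : T1 -> T1) (g : T2 -> T2) :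
  measure_preserving m1 f -> measure_preserving m2 g ->
  measure_preserving (m1 \x m2) (pair_map f g).
Proof.
move=> fP gP; have [[mf _] [mg gm]] := (fP, gP); split=> [|A mA].
  by apply/measurable_fun_pair;
    [exact: (measurableT_comp mf)|exact: (measurableT_comp mg)].
rewrite /product_measure1 /=.
rewrite -[RHS](integral_comp_measure_preserving fP)//; last first.
  exact: measurable_fun_xsection.
apply: eq_integral => x _ /=.
rewrite -(gm (xsection A (f x))); last exact: measurable_xsection.
by congr (m2 _); apply/seteqP; split=> y;
  rewrite /preimage /= /xsection /= !inE.
Qed.

End product_preserving.

(** * Coordinatewise maps and boxes in dimension n *)

Section tuples.
Context {R : realType}.
Local Open Scope ereal_scope.

Definition tuple_map n (s : 'I_n -> R -> R) (x : n.-tuple R) : n.-tuple R :=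
  [tuple s i (tnth x i) | i < n].

Lemma tuple_map_cons n (s : 'I_n.+1 -> R -> R) (z : R * n.-tuple R) :
  tuple_map s (cons_pair z) =
  cons_pair (pair_map (s ord0) (tuple_map (s \o lift ord0)) z).
Proof.
apply: eq_from_tnth => i; rewrite tnth_mktuple.
by case: (unliftP ord0 i) => [j|] ->; rewrite ?tnth0 ?tnthS ?tnth_mktuple.
Qed.

Lemma measurable_tuple_map n (s : 'I_n -> R -> R) :
  (forall i, measurable_fun setT
    (s i : measurableTypeR R -> measurableTypeR R)) ->
  measurable_fun setT (tuple_map s :
    n.-tuple (measurableTypeR R) -> n.-tuple (measurableTypeR R)).
Proof.
move=> ms; apply/measurable_fun_tnthP => i.
rewrite (_ : _ \o _ = s i \o (@tnth _ _)^~ i).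
  exact: measurableT_comp (ms i) (measurable_tnth i).
by apply/funext => x /=; rewrite tnth_mktuple.
Qed.

(** Induction along the construction of the measure: [cons_pair] turns a coordinatewise map into a
    product map. *)
Lemma borel_lebesgue_map n (s : 'I_n -> R -> R) :
  (forall i, measure_preserving (@lebesgue_measure R) (s i)) ->
  measure_preserving (@borel_lebesgue R n) (tuple_map s).
Proof.
move=> sP; split=> [|A mA].
  by apply: measurable_tuple_map => i; exact: (sP i).1.
elim: n s sP A mA => [s _ A _|n IH s sP A mA].
  rewrite (_ : _ @^-1` _ = A)//.
  by apply/seteqP; split=> x;
    rewrite /preimage /= (tuple0 (tuple_map _ _)) (tuple0 x).
rewrite /= /cons_measure /pushforward -comp_preimage.
rewrite (_ : tuple_map s \o _ =
  @cons_pair R n \o pair_map (s ord0) (tuple_map (s \o lift ord0))); last first.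
  by apply/funext => z /=; rewrite tuple_map_cons.
rewrite comp_preimage.
apply: (product_measure_preserving (sP ord0) _).2; last first.
  by rewrite -[X in measurable X]setTI; exact: measurable_cons_pair.
split; first by apply: measurable_tuple_map => i; exact: (sP _).1.
by apply: IH => i; exact: sP.
Qed.

Definition tuple_box n (A : 'I_n -> set R) : set (n.-tuple R) :=
  [set x | forall i, A i (tnth x i)].

Lemma measurable_tuple_box n (A : 'I_n -> set (measurableTypeR R)) :
  (forall i, measurable (A i)) ->
  measurable (tuple_box A : set (n.-tuple (measurableTypeR R))).
Proof.
move=> mA; rewrite (_ : tuple_box A =
  \bigcap_(i in [set: 'I_n]) ((@tnth n R)^~ i @^-1` A i)); last first.
  by apply/seteqP; split=> [x Ax i _|x Ax i]; exact: Ax.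
apply: fin_bigcap_measurable => // i _.
by rewrite -[X in measurable X]setTI; exact: measurable_tnth.
Qed.

Lemma borel_lebesgue_box n (A : 'I_n -> set (measurableTypeR R)) :
  (forall i, measurable (A i)) ->
  @borel_lebesgue R n (tuple_box A) = \prod_(i < n) lebesgue_measure (A i).
Proof.
elim: n A => [|n IH] A mA.
  rewrite big_ord0 /= diracE mem_set//; by case.
rewrite /= /cons_measure /pushforward big_ord_recl -IH//.
rewrite -product_measure1E//; last exact: measurable_tuple_box.
congr product_measure1; apply/seteqP; split=> [z Az|z [/= Az Bz] i].
  split=> [|i]; first by have := Az ord0; rewrite tnth0.
  by have := Az (lift ord0 i); rewrite tnthS.
by case: (unliftP ord0 i) => [j|] ->; rewrite ?tnth0 ?tnthS; [exact: Bz|].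
Qed.

End tuples.

(** * Invariance of the completed measures *)

Section completed_isom.
Context {R : realType}.
Local Open Scope ereal_scope.

Lemma completed_lebesgue_measure_isom e c :
  measure_preserving (@completed_lebesgue_measure R) (isom e c).
Proof.
(* The completed measure on the line extends the length of half-open intervals, so the criterion is
   applied to that semiring. *)
pose mu : {measure set (ocitv_type R) -> \bar R} := @wlength R idfun.
have := @completed_measure_preserving _ (ocitv_type R) R mu _ _
  (isomK e c) (isom_invK e c).
have mu_ext_isom e' c' (A : set (ocitv_type R)) : measurable A ->
    (mu^*)%mu (isom e' c' @^-1` A) <= mu A.
  move=> mA; rewrite -(measurable_mu_extE mu mA) le_eqVlt; apply/orP; left.
  have mA' : measurable (A : set (measurableTypeR R)).
    by exact: sub_sigma_algebra.
  by apply/eqP; exact: (lebesgue_measure_isom e' c').2 mA'.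
by apply => A mA; exact: mu_ext_isom.
Qed.

Lemma completed_measure_preservingT d (T : measurableType d)
    (mu : {measure set T -> \bar R}) (s t : T -> T) :
  cancel s t -> cancel t s ->
  measure_preserving mu s -> measure_preserving mu t ->
  measure_preserving (@completed_measure_extension _ _ _ mu) s.
Proof.
move=> st ts sP tP.
have le_mu (r : T -> T) : measure_preserving mu r ->
    forall A, measurable A -> (mu^*)%mu (r @^-1` A) <= mu A.
  move=> [mr rmu] A mA; rewrite measurable_mu_extE ?rmu//.
  by rewrite -[X in measurable X]setTI; exact: mr.
by apply: (completed_measure_preserving st ts); exact: le_mu.
Qed.

Definition tuple_isom d (e : 'I_d -> bool) (c : 'I_d -> R) :=
  tuple_map (fun i => isom (e i) (c i)).

Definition tuple_isom_inv d (e : 'I_d -> bool) (c : 'I_d -> R) :=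
  tuple_map (fun i => isom_inv (e i) (c i)).

Lemma tuple_isomK d (e : 'I_d -> bool) (c : 'I_d -> R) :
  cancel (tuple_isom e c) (tuple_isom_inv e c).
Proof.
by move=> x; apply: eq_from_tnth => i; rewrite !tnth_mktuple isomK.
Qed.

Lemma tuple_isom_invK d (e : 'I_d -> bool) (c : 'I_d -> R) :
  cancel (tuple_isom_inv e c) (tuple_isom e c).
Proof.
by move=> x; apply: eq_from_tnth => i; rewrite !tnth_mktuple isom_invK.
Qed.

Lemma borel_lebesgue_isom d (e : 'I_d -> bool) (c : 'I_d -> R) :
  measure_preserving (@borel_lebesgue R d) (tuple_isom e c).
Proof. by apply: borel_lebesgue_map => i; exact: lebesgue_measure_isom. Qed.

Lemma lebesgue_space_isom d (e : 'I_d -> bool) (c : 'I_d -> R) :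
  measure_preserving (@lebesgue_space R d) (tuple_isom e c).
Proof.
have := @completed_measure_preservingT _ (d.-tuple (measurableTypeR R))
  (@borel_lebesgue R d) _ _ (tuple_isomK e c) (tuple_isom_invK e c).
by apply; exact: borel_lebesgue_isom.
Qed.

Definition pair_isom d (e0 : bool) (c0 : R)
    (e : 'I_d -> bool) (c : 'I_d -> R) :=
  pair_map (isom e0 c0) (tuple_isom e c).

(** This is the invariance behind [lebesgue_measurable_fun]; it makes the folded function
    measurable. *)
Lemma completed_product_isom d e0 c0 (e : 'I_d -> bool) (c : 'I_d -> R) :
  measure_preserving
    (@completed_measure_extension _ _ _
      (@lebesgue_measure R \x @borel_lebesgue R d))
    (pair_isom e0 c0 e c).
Proof.
have pairK : cancel (pair_isom e0 c0 e c)
    (pair_map (isom_inv e0 c0) (tuple_isom_inv e c)).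
  by move=> [t x]; rewrite /pair_isom /pair_map /= isomK tuple_isomK.
have pair_invK : cancel (pair_map (isom_inv e0 c0) (tuple_isom_inv e c))
    (pair_isom e0 c0 e c).
  by move=> [t x]; rewrite /pair_isom /pair_map /= isom_invK tuple_isom_invK.
have := @completed_measure_preservingT _
  (measurableTypeR R * d.-tuple (measurableTypeR R))%type
  (@lebesgue_measure R \x @borel_lebesgue R d) _ _ pairK pair_invK.
by apply; apply: product_measure_preserving;
  [exact: lebesgue_measure_isom|exact: borel_lebesgue_isom
  |exact: lebesgue_measure_isom|exact: borel_lebesgue_isom].
Qed.

End completed_isom.

(** * The triangle wave *)

Section fold.
Context {R : realType}.
Implicit Types (m k : int) (t s L y : R).

(* On the cell [m, m + 1) the triangle wave is t - m for even m and m + 1 - t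
   for odd m. *)
Definition odd_cell m : bool := ~~ (2 %| m)%Z.

(** The even endpoint of the cell, where the triangle wave vanishes. *)
Definition cell_offset m : R := (m + odd_cell m)%:~R.

Definition fold_cell m : R -> R := isom_inv (odd_cell m) (cell_offset m).

Definition unfold_cell m : R -> R := isom (odd_cell m) (cell_offset m).

Definition fold t : R := fold_cell (Num.floor t) t.

Lemma odd_cellP m : exists k,
  m = 2 * k /\ odd_cell m = false \/ m + 1 = 2 * k /\ odd_cell m = true.
Proof.
rewrite /odd_cell; case: (boolP (2 %| m)%Z) => [/dvdzP[k ->]|/negP n2m].
  by exists k; left; rewrite mulrC.
exists ((m %/ 2)%Z + 1); right; split => //; have := divz_eq m 2; lia.
Qed.
(** Reduces facts about [fold] to linear arithmetic on the two branches, with the parity of the cell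
    made explicit by [k]. *)
Lemma foldP t : exists m k : int, [/\ m%:~R <= t, t < m%:~R + 1 &
  m = 2 * k /\ fold t = t - m%:~R \/ m + 1 = 2 * k /\ fold t = m%:~R + 1 - t].
Proof.
have /andP[mt tm] := floor_itv t; rewrite intrD in tm.
rewrite /fold /fold_cell /isom_inv /isom /cell_offset.
move: (Num.floor t) mt tm => m mt tm; have [k km] := odd_cellP m.
exists m, k; split=> //; case: km => -[mk ->]; [left|right]; split=> //.
  by rewrite addr0 expr0 mul1r mulN1r.
by rewrite expr1 opprK mul1r mulN1r intrD addrC.
Qed.

Lemma fold_ge0 t : 0 <= fold t.
Proof. by have [m [k [mt tm [[_ ->]|[_ ->]]]]] := foldP t; lra. Qed.

Lemma fold_le1 t : fold t <= 1.
Proof. by have [m [k [mt tm [[_ ->]|[_ ->]]]]] := foldP t; lra. Qed.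

Lemma fold_id t : 0 < t < 1 -> fold t = t.
Proof.
move=> /andP[t0 t1]; have [m [k [mt tm mk]]] := foldP t.
have m0 : m = 0.
  have : (m%:~R < 1%:~R :> R) by apply: le_lt_trans mt _.
  have : ((-1)%:~R < m%:~R :> R).
    by rewrite -(ltrD2r 1); apply: lt_trans tm; rewrite addNr.
  by rewrite !ltr_int; lia.
by case: mk; rewrite m0 => -[m2k ->]; [rewrite subr0|exfalso; lia].
Qed.

(* [fold t] is the distance from [t] to the even integers, hence 1-Lipschitz. *)
Lemma fold_le_dist t k : fold t <= `|t - (2 * k)%:~R|.
Proof.
have le_intr (a b : int) : a <= b -> a%:~R <= b%:~R :> R by rewrite ler_int.
have [m [j [mt tm [[mj ->]|[mj ->]]]]] := foldP t.
  have [km|mk] : 2 * k <= m \/ m + 2 <= 2 * k by lia.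
    by have := le_intr _ _ km; case: (ger0P (t - _)); lra.
  by have := le_intr _ _ mk; rewrite intrD; case: (ger0P (t - _)); lra.
have [km|mk] : 2 * k <= m - 1 \/ m + 1 <= 2 * k by lia.
  by have := le_intr _ _ km; rewrite intrB; case: (ger0P (t - _)); lra.
by have := le_intr _ _ mk; rewrite intrD; case: (ger0P (t - _)); lra.
Qed.

Lemma fold_lipschitz s t : fold t <= fold s + `|t - s|.
Proof.
(* An even integer nearest to [s] realizes [fold s]; the same integer bounds [fold t] from above,
   and the triangle inequality compares the two. *)
have [k ->] : exists k : int, fold s = `|s - (2 * k)%:~R|.
  have [m [k [mt tm mk]]] := foldP s; exists k.
  case: mk => -[<- ->]; first by rewrite ger0_norm ?subr_ge0.
  by rewrite intrD ler0_norm ?opprB//; lra.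
apply: le_trans (fold_le_dist t k) _; rewrite [leRHS]addrC.
have -> : t - (2 * k)%:~R = (t - s) + (s - (2 * k)%:~R) by rewrite addrA subrK.
exact: ler_normD.
Qed.

Lemma fold_unfold m y : Num.floor (unfold_cell m y) = m ->
  fold (unfold_cell m y) = y.
Proof. by move=> fm; rewrite /fold fm; exact: isomK. Qed.

(* Being 1-Lipschitz, [fold] maps ]s, s + L[ into the ball of radius L / 2 about
   the image of the midpoint; the clamping moves that ball inside [0, 1]. *)
Definition fold_start s L : R :=
  Num.max 0 (Num.min (fold (s + L / 2) - L / 2) (1 - Num.min L 1)).

(** For positive [L] this is the ceiling of [L] plus one, a bound on the number of unit cells met by
    an open interval of length [L]. *)
Definition ncells L : nat := `|Num.ceil L|.+1.

Lemma fold_start_ge0 s L : 0 <= fold_start s L.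
Proof. by rewrite /fold_start le_max lexx. Qed.

Lemma fold_start_le1 s L : fold_start s L + Num.min L 1 <= 1.
Proof.
rewrite /fold_start; set u := fold _ - _.
by case: (leP L 1) => L1; case: (leP u _) => ?; case: (leP 0 _) => ?; lra.
Qed.

Lemma fold_in_itv s L t : s < t < s + L ->
  fold_start s L <= fold t <= fold_start s L + Num.min L 1.
Proof.
move=> /andP[st tsL]; rewrite /fold_start.
have u1 := fold_lipschitz (s + L / 2) t.
have u2 := fold_lipschitz t (s + L / 2); rewrite distrC in u2.
have h : `|t - (s + L / 2)| < L / 2 by rewrite ltr_norml; lra.
have f0 := fold_ge0 t; have f1 := fold_le1 t.
have g0 := fold_ge0 (s + L / 2); have g1 := fold_le1 (s + L / 2).
set u := fold (s + L / 2) in u1 u2 g0 g1 *.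
case: (leP L 1) => L1; case: (leP (u - _) _) => ?; case: (leP 0 _) => ?; lra.
Qed.

Lemma floor_ncells s L t : s < t < s + L ->
  exists j : 'I_(ncells L), Num.floor t = Num.floor s + j%:Z.
Proof.
move=> /andP[st tsL].
have /andP[fs sf] := floor_itv s; have /andP[ft tf] := floor_itv t.
have /andP[_ Lc] := ceil_itv L.
have L0 : 0 < L by lra.
have c0 : 0 <= Num.ceil L by rewrite -(ler_int R); lra.
have st1 : Num.floor s <= Num.floor t by apply: le_floor; exact: ltW.
have st2 : Num.floor t < Num.floor s + 1 + Num.ceil L.
  by rewrite -(ltr_int R) intrD; lra.
have jn : (`|Num.floor t - Num.floor s|%N < ncells L)%N by rewrite /ncells; lia.
by exists (Ordinal jn) => /=; lia.
Qed.

(** Source of the factor 3. If [L <= 1] there are two cells, and [2 * L <= 3 * L]; if [L > 1] the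
    count is below [L + 2], hence below [3 * L]. *)
Lemma ncells_le L : 0 < L -> (ncells L)%:R * Num.min L 1 <= 3 * L.
Proof.
move=> L0; rewrite /ncells.
have /andP[cL Lc] := ceil_itv L.
have c0 : 0 <= Num.ceil L by rewrite -(ler_int R); lra.
have cE : (`|Num.ceil L|.+1)%:R = (Num.ceil L)%:~R + 1 :> R.
  by rewrite -natr1 natr_absz ger0_norm.
rewrite cE; rewrite intrB in cL.
case: (leP L 1) => L1; last by nra.
have c1 : Num.ceil L <= 1.
  have : (Num.ceil L - 1)%:~R < 1%:~R :> R by rewrite intrB; lra.
  by rewrite ltr_int; lia.
have : (Num.ceil L)%:~R <= 1%:~R :> R by rewrite ler_int.
by nra.
Qed.

(** Keeps the folded box parabolic: its duration is the square of its spatial side. *)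
Lemma min_sqr (rho : R) : (0 < rho)%R ->
  (Num.min (rho ^+ 2) 1 = (Num.min rho 1) ^+ 2)%R.
Proof. by move=> rho0; case: (leP rho 1%R) => ?; case: leP; nra. Qed.

End fold.

(** * Folding boxes *)

Section fold_integrals.
Context {R : realType}.
Local Open Scope ereal_scope.

Lemma completed_measurable_itv (i : interval R) :
  ((@wlength R idfun)^*)%mu.-cara.-measurable [set` i].
Proof. by apply: sub_caratheodory; exact: measurable_itv. Qed.

Lemma lebesgue_measure_itvL (b1 b2 : bool) (s L : R) : (0 <= L)%R ->
  lebesgue_measure [set` Interval (BSide b1 s) (BSide b2 (s + L)%R)] = L%:E.
Proof.
move=> L0; rewrite lebesgue_measure_itv/= lte_fin ltrDl -EFinB addrC addKr.
by case: ltP => // L0'; congr EFin; apply/eqP; rewrite eq_le L0.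
Qed.


Lemma integral_fold_itv (s L : R) (f : R -> \bar R) : (0 < L)%R ->
  (forall t, 0 <= f t) ->
  \int[completed_lebesgue_measure]_(t in `]s, (s + L)%R[) f (fold t) <=
  (ncells L)%:R%:E * \int[completed_lebesgue_measure]_(t in
    `]fold_start s L, (fold_start s L + Num.min L 1)%R[) f t.
Proof.
move=> L0 f0; set c := fold_start s L; set L' := Num.min L 1%R.
have L'0 : (0 <= L')%R by rewrite le_min ltW//=.
pose cell (j : 'I_(ncells L)) : int := (Num.floor s + j%:Z)%R.
have := @integral_fold_le _ _ R (@completed_lebesgue_measure R)
  'I_(ncells L) (fun j => unfold_cell (cell j))
  (fun j => [set` `[(cell j)%:~R, ((cell j)%:~R + 1)%R[])
  [set` `]s, (s + L)%R[] [set` `[c, (c + L')%R]] fold f.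
rewrite card_ord => /(_ _ _ _ _ _ f0) fold_le.
apply: le_trans (fold_le _ _ _ _ _) _.
- exact: completed_measurable_itv.
- by move=> j; exact: completed_measurable_itv.
- by move=> j; exact: completed_lebesgue_measure_isom.
- move=> t /=; rewrite in_itv/= => /floor_ncells[j tj]; exists j => //=.
  by rewrite in_itv/= /cell -tj -intrD1 floor_itv.
- move=> j x; rewrite /= !in_itv /= => tD tj; rewrite fold_unfold; last first.
    by apply: floor_def; rewrite intrD.
  split=> //; rewrite -[x in (_ <= x <= _)%R](@fold_unfold _ (cell j)).
    exact: fold_in_itv.
  by apply: floor_def; rewrite intrD.
(* Folding lands in a closed interval, as the wave may attain the bounds; the endpoints are null and
   are removed to obtain an open interval. *)
- apply: lee_pmul => //; first exact: integral_ge0.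
  have clE b1 b2 : @completed_lebesgue_measure R
      [set` Interval (BSide b1 c) (BSide b2 (c + L')%R)] = L'%:E.
    exact: lebesgue_measure_itvL.
  apply: integral_le_eq_measure => //.
  + exact: completed_measurable_itv.
  + exact: completed_measurable_itv.
  + by move=> t /=; rewrite !in_itv/= => /andP[/ltW -> /ltW ->].
  + exact: etrans (clE _ _) (esym (clE _ _)).
  + by apply: (@le_lt_trans _ _ L'%:E); rewrite ?ltry// -(clE true false).
Qed.

Lemma lebesgue_space_borel d (A : set (d.-tuple (measurableTypeR R))) :
  measurable A -> lebesgue_space d A = borel_lebesgue d A.
Proof. exact: measurable_mu_extE. Qed.

Lemma lebesgue_space_measurable d (A : set (d.-tuple (measurableTypeR R))) :
  measurable A -> ((borel_lebesgue d)^*)%mu.-cara.-measurable A.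
Proof. exact: caratheodory_measurable_mu_ext. Qed.

Lemma lebesgue_space_box d (b1 b2 : bool) (x : d.-tuple R) (L : R) :
  (0 <= L)%R ->
  lebesgue_space d (tuple_box (fun i : 'I_d =>
    [set` Interval (BSide b1 (tnth x i)) (BSide b2 (tnth x i + L)%R)])) =
  (L ^+ d)%:E.
Proof.
move=> L0; rewrite lebesgue_space_borel; last exact: measurable_tuple_box.
rewrite borel_lebesgue_box//.
under eq_bigr do rewrite lebesgue_measure_itvL//.
by rewrite prodEFin prodr_const card_ord.
Qed.

Lemma cubeE d (x : d.-tuple R) (L : R) :
  cube x L = tuple_box (fun i : 'I_d => `]tnth x i, (tnth x i + L)%R[%classic).
Proof.
by apply/seteqP; split=> y yx i; have := yx i; rewrite /= in_itv.
Qed.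

Definition tuple_fold d : d.-tuple R -> d.-tuple R := tuple_map (fun=> fold).

Definition fold_corner d (x : d.-tuple R) (L : R) : d.-tuple R :=
  [tuple fold_start (tnth x i) L | i < d].

(** A branch is a choice of one unit cell in each coordinate, which gives the power [d] of
    [ncells L]. *)
Lemma integral_fold_cube d (x : d.-tuple R) (L : R) (f : d.-tuple R -> \bar R) :
  (0 < L)%R -> (forall y, 0 <= f y) ->
  \int[lebesgue_space d]_(y in cube x L) f (tuple_fold y) <=
  (ncells L ^ d)%:R%:E *
    \int[lebesgue_space d]_(y in cube (fold_corner x L) (Num.min L 1%R)) f y.
Proof.
move=> L0 f0; set c := fold_corner x L; set L' := Num.min L 1%R.
have L'0 : (0 <= L')%R by rewrite le_min ltW//=.
pose cell (j : {ffun 'I_d -> 'I_(ncells L)}) i : int :=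
  (Num.floor (tnth x i) + (j i)%:Z)%R.
pose closed_box := tuple_box (fun i : 'I_d =>
  `[tnth c i, (tnth c i + L')%R]%classic).
have mbox b1 b2 (y z : 'I_d -> R) :
  ((borel_lebesgue d)^*)%mu.-cara.-measurable (tuple_box (fun i : 'I_d =>
    [set` Interval (BSide b1 (y i)) (BSide b2 (z i))])).
  by apply: lebesgue_space_measurable; apply: measurable_tuple_box.
have := @integral_fold_le _ _ R (@lebesgue_space R d)
  {ffun 'I_d -> 'I_(ncells L)}
  (fun j => tuple_isom (odd_cell \o cell j) (cell_offset \o cell j))
  (fun j => tuple_box (fun i =>
    `[(cell j i)%:~R, ((cell j i)%:~R + 1)%R[%classic))
  (cube x L) closed_box (@tuple_fold d) f.
rewrite card_ffun !card_ord => /(_ _ _ _ _ _ f0) fold_le.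
apply: le_trans (fold_le _ _ _ _ _) _.
- by rewrite cubeE; exact: mbox.
- by move=> j; exact: mbox.
- by move=> j; exact: lebesgue_space_isom.
- move=> y xy; have /(_ _)/cid-/all_sig[j jP] := fun i => floor_ncells (xy i).
  exists [ffun i => j i] => // i /=.
  by rewrite in_itv/= /cell ffunE -jP -intrD1 floor_itv.
- move=> j y yx ycell.
  have fy i : fold (unfold_cell (cell j i) (tnth y i)) = tnth y i.
    apply: fold_unfold; apply: floor_def; rewrite intrD.
    by have := ycell i; rewrite tnth_mktuple/= in_itv.
  split=> [i|]; last first.
    by apply: eq_from_tnth => i; rewrite !tnth_mktuple; exact: fy.
  rewrite /= in_itv/= tnth_mktuple -fy; apply: fold_in_itv.
  by have := yx i; rewrite tnth_mktuple.
- apply: lee_pmul => //; first exact: integral_ge0.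
  have cubeL' : lebesgue_space d (cube c L') = (L' ^+ d)%:E.
    by rewrite cubeE lebesgue_space_box.
  have boxL' : lebesgue_space d closed_box = (L' ^+ d)%:E.
    exact: lebesgue_space_box.
  apply: integral_le_eq_measure => //.
  + exact: mbox.
  + by rewrite cubeE; exact: mbox.
  + move=> y yc i; have := yc i.
    by rewrite /= in_itv/= => /andP[/ltW -> /ltW ->].
  + exact: etrans cubeL' (esym boxL').
  + by apply: (@le_lt_trans _ _ (L' ^+ d)%:E); rewrite ?ltry// -boxL'.
Qed.

End fold_integrals.

(** * The extension and its measurability *)

Section extension.
Context {R : realType} {d : nat}.
Implicit Types (a : R * d.-tuple R -> R) (z : R * d.-tuple R).

Definition box_fold z : R * d.-tuple R := (fold z.1, tuple_fold z.2).

(** Cutting [a] off first makes the values independent of [a] outside the open cube: the extension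
    is 0 where [box_fold] hits the boundary, that is, where some coordinate is an integer. *)
Definition fold_extension a : R * d.-tuple R -> R :=
  (a \_ unit_cube) \o box_fold.

Lemma fold_extension_id a z : unit_cube z -> fold_extension a z = a z.
Proof.
case: z => t x [/= t01 x01]; rewrite /fold_extension /=.
rewrite (_ : box_fold (t, x) = (t, x)).
  by rewrite patchE mem_set.
congr pair; first exact: fold_id.
by apply: eq_from_tnth => i; rewrite tnth_mktuple fold_id.
Qed.

Lemma unit_cubeE :
  @unit_cube R d = [set` `]0, 1[] `*` tuple_box (fun=> `]0, 1[%classic).
Proof.
apply/seteqP; split=> -[t x] [t01 x01].
  by split=> [|i]; [|have := x01 i]; rewrite /= in_itv.
by split=> [|i]; [move: t01|have := x01 i]; rewrite /= in_itv.
Qed.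

Lemma measurable_fold_extension a : lebesgue_measurable_fun unit_cube a ->
  lebesgue_measurable_fun setT (fold_extension a).
Proof.
pose mu : {measure set (measurableTypeR R * d.-tuple (measurableTypeR R))%type
  -> \bar R} := (@lebesgue_measure R \x @borel_lebesgue R d)%E.
rewrite /lebesgue_measurable_fun => ma.
have mX (A : set (measurableTypeR R)) (B : set (d.-tuple (measurableTypeR R))) :
    measurable A -> measurable B -> (mu^*)%mu.-cara.-measurable (A `*` B).
  by move=> mA mB; apply: caratheodory_measurable_mu_ext; exact: measurableX.
have mcube : (mu^*)%mu.-cara.-measurable unit_cube.
  by rewrite unit_cubeE; apply: mX => //; exact: measurable_tuple_box.
have mb := (@measurable_restrictT _ _ (caratheodory_type (mu^*)%mu) _
  _ a mcube).1 ma.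
move=> _ B mB; rewrite setTI.
pose E (k : int * {ffun 'I_d -> int}) : set (R * d.-tuple R) :=
  `[k.1%:~R, k.1%:~R + 1[%classic `*`
  tuple_box (fun i => `[(k.2 i)%:~R, (k.2 i)%:~R + 1[%classic).
pose s (k : int * {ffun 'I_d -> int}) : R * d.-tuple R -> R * d.-tuple R :=
  pair_map (fold_cell k.1) (tuple_map (fun i => fold_cell (k.2 i))).
(* The integer cells [E k] are countably many and cover the space, and on each of them [box_fold] is
   the isometry [s k]. *)
rewrite (_ : _ @^-1` B =
    \bigcup_k (E k `&` s k @^-1` ((a \_ unit_cube) @^-1` B))); last first.
  have sE k z : E k z -> box_fold z = s k z.
    move=> [k1 k2]; congr pair.
      by rewrite /fold (@floor_def _ _ k.1) // intrD; exact: k1.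
    apply: eq_from_tnth => i; rewrite !tnth_mktuple /fold.
    by rewrite (@floor_def _ _ (k.2 i)) // intrD; exact: k2.
  apply/seteqP; split=> [z Bz|z [k _ [Ek]]]; last first.
    by rewrite /preimage /= /fold_extension /= (sE k).
  pose k := (Num.floor z.1, [ffun i => Num.floor (tnth z.2 i)]).
  have Ekz : E k z.
    split=> [|i] /=; rewrite in_itv/= ?ffunE -intrD1 floor_itv//.
  by exists k => //; split => //; rewrite /preimage /= -(sE k).
apply: countable_bigcupT_measurable => [|k]; first exact: countableP.
apply: measurableI.
  apply: mX; first exact: measurable_itv.
  by apply: measurable_tuple_box => i; exact: measurable_itv.
rewrite -[X in measurable X]setTI.
apply: (completed_product_isom _ _ _ _).1 => //.
by rewrite -[X in measurable X]setTI; exact: mb.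
Qed.

End extension.

(** * Oscillation of the extension over a box *)

Section oscillation.
Context {R : realType} {d : nat}.
Implicit Types (a : R * d.-tuple R -> R).
Local Open Scope ereal_scope.

Definition osc a (C : set (d.-tuple R)) (t : R) : \bar R :=
  \int[lebesgue_space d]_(y in C) \int[lebesgue_space d]_(x in C)
    `|a (t, x) - a (t, y)|%:E.

Lemma osc_ge0 a C t : 0 <= osc a C t.
Proof. by apply: integral_ge0 => y _; exact: integral_ge0. Qed.

(** Fold the inner variable with [y] fixed, take the constant out of the outer integral by
    [integral_mulr_le], then fold [y]: each variable costs [K]. *)
Lemma osc_fold_le a (x : d.-tuple R) (rho t : R) : (0 < rho)%R ->
  osc (a \o box_fold) (cube x rho) t <=
  ((ncells rho ^ d) ^ 2)%:R%:E *
    osc a (cube (fold_corner x rho) (Num.min rho 1%R)) (fold t).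
Proof.
move=> rho0; set C' := cube (fold_corner x rho) _; set K := (ncells rho ^ d)%N.
have K0 : (0 < K%:R :> R)%R by rewrite ltr0n expn_gt0.
pose H y := \int[lebesgue_space d]_(x in C')
  `|a (fold t, x) - a (fold t, y)|%:E.
have H0 y : 0 <= H y by exact: integral_ge0.
apply: (@le_trans _ _ (\int[lebesgue_space d]_(y in cube x rho)
    (K%:R%:E * H (tuple_fold y)))).
  apply: le_integral_ge0 => y _; first exact: integral_ge0.
  exact: (@integral_fold_cube _ _ _ _ (fun x =>
    `|a (fold t, x) - a (fold t, tuple_fold y)|%:E)).
have /(_ _)/le_trans := @integral_mulr_le _ _ R (@lebesgue_space R d)
  (cube x rho) (H \o @tuple_fold R d) _ K0.
apply=> [y _|]; first exact: H0.
rewrite -mulnn natrM EFinM -muleA.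
apply: lee_pmul => //; first by apply: integral_ge0 => y _; exact: H0.
exact: (@integral_fold_cube _ _ _ _ H).
Qed.

Lemma integral_osc_fold_le a (x : d.-tuple R) (rho s L : R) :
  (0 < rho)%R -> (0 < L)%R ->
  \int[completed_lebesgue_measure]_(t in `]s, (s + L)%R[)
    osc (a \o box_fold) (cube x rho) t <=
  ((ncells rho ^ d) ^ 2 * ncells L)%:R%:E *
  \int[completed_lebesgue_measure]_(t in
      `]fold_start s L, (fold_start s L + Num.min L 1%R)%R[)
    osc a (cube (fold_corner x rho) (Num.min rho 1%R)) t.
Proof.
move=> rho0 L0; set C' := cube (fold_corner x rho) _.
set K := ((ncells rho ^ d) ^ 2)%N.
have K0 : (0 < K%:R :> R)%R by rewrite ltr0n !expn_gt0.
apply: (@le_trans _ _ (\int[completed_lebesgue_measure]_(t in `]s, (s + L)%R[)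
    (K%:R%:E * osc a C' (fold t)))).
  by apply: le_integral_ge0 => t _; [exact: osc_ge0|exact: osc_fold_le].
have /(_ _)/le_trans := @integral_mulr_le _ _ R (@completed_lebesgue_measure R)
  [set` `]s, (s + L)%R[] (osc a C' \o fold) _ K0.
apply=> [t _|]; first exact: osc_ge0.
rewrite natrM EFinM -muleA.
apply: lee_pmul => //.
  by apply: integral_ge0 => t _; exact: osc_ge0.
by apply: (@integral_fold_itv _ _ _ (osc a C')) => // t; exact: osc_ge0.
Qed.

Lemma mean_oscillationE a (s rho : R) (x : d.-tuple R) : (0 < rho)%R ->
  mean_oscillation a (`]s, (s + rho ^+ 2)%R[%classic, cube x rho) =
  (\int[completed_lebesgue_measure]_(t in `]s, (s + rho ^+ 2)%R[)
    osc a (cube x rho) t) * ((rho ^+ 2 * (rho ^+ d) ^+ 2)^-1)%:E.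
Proof.
move=> rho0; rewrite /mean_oscillation /=.
have -> : completed_lebesgue_measure `]s, (s + rho ^+ 2)%R[%classic =
    (rho ^+ 2)%:E.
  by apply: lebesgue_measure_itvL; rewrite sqr_ge0.
have -> : lebesgue_space d (cube x rho) = (rho ^+ d)%:E.
  by rewrite cubeE lebesgue_space_box// ltW.
by rewrite -!EFinM -expr2 inver gt_eqF ?mulr_gt0 ?exprn_gt0.
Qed.

Lemma fold_mean_oscillation_le a (s rho : R) (x : d.-tuple R) : (0 < rho)%R ->
  mean_oscillation (fold_extension a)
    (`]s, (s + rho ^+ 2)%R[%classic, cube x rho) <=
  (3 ^+ (2 + 2 * d))%:E * bmo_seminorm 1%:E unit_cube a.
Proof.
move=> rho0; set r := Num.min rho 1%R.
have r0 : (0 < r)%R by rewrite lt_min rho0 ltr01.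
set c := fold_start s (rho ^+ 2).
(* The folded box: an admissible box of side at most 1 inside the cube, hence a competitor in the
   seminorm of [a]. *)
pose Q := (`]c, (c + r ^+ 2)%R[%classic, cube (fold_corner x rho) r).
have QP : Q.1 `*` Q.2 `<=` unit_cube.
  have c0 := fold_start_ge0 s (rho ^+ 2).
  have c1 := fold_start_le1 s (rho ^+ 2); rewrite min_sqr// -/r -/c in c0 c1.
  move=> [t y] /= [tc yc]; split => [|i] /=.
    by move: tc; rewrite in_itv/=; lra.
  have x0 := fold_start_ge0 (tnth x i) rho.
  have x1 := fold_start_le1 (tnth x i) rho.
  by have := yc i; rewrite tnth_mktuple -/r in x1 *; lra.
have QB : mean_oscillation a Q <= bmo_seminorm 1%:E unit_cube a.
  apply: ereal_sup_ubound; exists Q => //; exists r.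
    by split=> //; rewrite lee_fin ge_min lexx orbT.
  by split=> //; exists c, (fold_corner x rho).
have Q0 : 0 <= mean_oscillation a Q.
  rewrite mean_oscillationE//; apply: mule_ge0.
    by apply: integral_ge0 => t _; exact: osc_ge0.
  by rewrite lee_fin invr_ge0 ltW// mulr_gt0 ?exprn_gt0.
have L0 : (0 < rho ^+ 2)%R by rewrite exprn_gt0.
apply: (@le_trans _ _
  ((3 ^+ (2 + 2 * d))%:E * mean_oscillation a Q)); last first.
  by apply: lee_pmul => //; rewrite lee_fin exprn_ge0.
have := integral_osc_fold_le (a \_ unit_cube) x s rho0 L0.
rewrite min_sqr// -/r -/c.
have -> : \int[completed_lebesgue_measure]_(t in `]c, (c + r ^+ 2)%R[)
    osc (a \_ unit_cube) (cube (fold_corner x rho) r) t =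
  \int[completed_lebesgue_measure]_(t in `]c, (c + r ^+ 2)%R[)
    osc a (cube (fold_corner x rho) r) t.
  apply: eq_integral => t /set_mem tc; apply: eq_integral => y /set_mem yc.
  apply: eq_integral => z /set_mem zc.
  by rewrite !patchE !mem_set//; apply: QP.
rewrite !mean_oscillationE//; set X := integral _ _ _; set Y := integral _ _ _.
move=> XY; have Y0 : 0 <= Y by apply: integral_ge0 => t _; exact: osc_ge0.
set D := (rho ^+ 2 * _)%R; set D' := (r ^+ 2 * _)%R.
have D0 : (0 < D)%R by rewrite mulr_gt0 ?exprn_gt0.
have D'0 : (0 < D')%R by rewrite mulr_gt0 ?exprn_gt0.
rewrite lee_pdivrMr//; apply: (le_trans XY).
(* Cancel [Y]: it remains to compare the number of branches times the volume factor [D'] with the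
   constant times [D]. *)
rewrite -(muleA _ (Y * _)) -(muleA Y) (muleC Y) muleA -!EFinM.
apply: lee_pmul => //; rewrite lee_fin mulrCA ler_pdivlMl// mulrC.
have n1 : ((ncells rho)%:R * r <= 3 * rho)%R by exact: ncells_le.
have n2 : ((ncells (rho ^+ 2))%:R * r ^+ 2 <= 3 * rho ^+ 2)%R.
  by rewrite -min_sqr//; exact: ncells_le.
rewrite natrM !natrX [leLHS](_ : _ =
  ((ncells rho)%:R * r) ^+ d ^+ 2 *
  ((ncells (rho ^+ 2))%:R * r ^+ 2))%R; last first.
  by rewrite /D' !exprMn; ring.
apply: (@le_trans _ _ ((3 * rho) ^+ d ^+ 2 * (3 * rho ^+ 2))%R).
  have nr0 : (0 <= (ncells rho)%:R * r)%R by rewrite mulr_ge0// ltW.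
  have rho3 : (0 <= 3 * rho)%R by rewrite mulr_ge0// ltW.
  apply: ler_pM => //; first by rewrite !exprn_ge0.
    by rewrite mulr_ge0// exprn_ge0// ltW.
  by do 2![apply: lerXn2r; rewrite ?nnegrE ?exprn_ge0//].
rewrite exprD mulnC exprM exprMn /D.
set p := (3 ^+ d)%R; set q := (rho ^+ d)%R.
have P0 : (0 <= p ^+ 2 * q ^+ 2 * rho ^+ 2)%R.
  by rewrite -!exprMn sqr_ge0.
(* The two spatial integrals cost [3 ^+ d] each and time costs 3, so the count yields the exponent
   [1 + 2 * d]; the claimed constant leaves a further factor 3. *)
rewrite [leLHS](_ : _ = 3 * (p ^+ 2 * q ^+ 2 * rho ^+ 2))%R; last by ring.
rewrite [leRHS](_ : _ = 9 * (p ^+ 2 * q ^+ 2 * rho ^+ 2))%R; last by ring.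
by apply: ler_wpM2r => //; rewrite ler_nat.
Qed.

End oscillation.

Theorem theorem2p2 (R : realType) (d : nat) (hd : (1 <= d)%N)
    (a : R * d.-tuple R -> R)
    (ma : lebesgue_measurable_fun unit_cube a)
    (bmo_a : bmo_x 1%:E unit_cube a) :
  exists ahat : R * d.-tuple R -> R,
    [/\ lebesgue_measurable_fun setT ahat,
        (forall z, unit_cube z -> ahat z = a z)
      & (bmo_seminorm +oo setT ahat
         <= (3 ^+ (2 + 2 * d))%:E * bmo_seminorm 1%:E unit_cube a)%E].
Proof.
exists (fold_extension a); split.
- exact: measurable_fold_extension.
- by move=> z; exact: fold_extension_id.
- apply: ge_ereal_sup => _ [_ [rho [rho0 _]] [[s [x ->]] _] <-].
  exact: fold_mean_oscillation_le.
Qed.
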